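(* Suppose that $F$ and $G$ satisfy Assumption A (stated in the context), let $\vartheta\in\mathcal P_c(\mathbb R^n)$, and let $u\in\mathcal U$. Let $t\mapsto\mu_t\in\mathcal X$ be the unique distributional solution of the nonlocal balance law $$\partial_t\mu_t+\nabla_x\cdot\big[F_t(u_t,\mu_t)\,\mu_t\big]=G_t(u_t,\mu_t)\,\mu_t,\quad t\in I,\qquad \mu_0=\vartheta,$$ and let $t\mapsto\rho_t\in\mathcal Y$ be the unique distributional solution of the nonlocal continuity equation $$\partial_t\rho_t+\nabla_{\bm x}\cdot\big[\bm F_t(u_t,\rho_t)\,\rho_t\big]=0,\quad t\in I,\qquad \rho_0=\vartheta\otimes\delta_1 .$$ Then $$\mu_t=\beta(\rho_t)\qquad\text{for all } t\in I.$$
   Context: Let $I=[0,T]$ with $T>0$, let $U\subset\mathbb R^m$ be compact, and let $\mathcal U=L^\infty(I;U)$ be the set of measurable controls $u\colon I\to U$. $\mathbb R^+=[0,\infty)$. $\mathcal X=\mathcal M_c^+(\mathbb R^n)$ is the set of nonnegative finite Borel measures on $\mathbb R^n$ with compact support; $\mathcal P_c(\cdot)$ denotes compactly supported Borel probability measures; $\mathcal Y=\mathcal P_c(\mathbb R^n\times\mathbb R^+)$, equipped with the $L^2$-Kantorovich (Wasserstein) distance $W_2$. $\mathcal X$ is equipped with the Kantorovich–Rubinstein distance induced by $\|\mu\|_K=\sup\{\int\phi\,d\mu:\ \phi\in C_b(\mathbb R^n),\ \max\{\|\phi\|_\infty,\mathrm{Lip}(\phi)\}\le1\}$. For compact $E\subset\mathbb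 R^n$, $\mathcal M^+(E)$ is the set of nonnegative finite measures supported in $E$. $\langle\mu,\phi\rangle=\int\phi\,d\mu$. Maps: $F\colon I\times U\times\mathcal X\times\mathbb R^n\to\mathbb R^n$ and $G\colon I\times U\times\mathcal X\times\mathbb R^n\to\mathbb R$, written $F_t(u,\mu,x)$, $G_t(u,\mu,x)$; $F_t(u,\mu)$ denotes $x\mapsto F_t(u,\mu,x)$, similarly for $G$. Assumption A: (i) $(t,u)\mapsto F_t(u,\mu,x)$ and $(t,u)\mapsto G_t(u,\mu,x)$ are continuous for all $\mu\in\mathcal X$, $x\in\mathbb R^n$; (ii) for each compact $E\subset\mathbb R^n$ there is $M_E>0$ with $|F_t(u,\mu,x)-F_t(u,\mu',x')|\le M_E(|x-x'|+\|\mu-\mu'\|_K)$ and $|G_t(u,\mu,x)-G_t(u,\mu',x')|\le M_E(|x-x'|+\|\mu-\mu'\|_K)$ for all $t\in I$, $u\in U$, $\mu,\mu'\in\mathcal M^+(E)$, $x,x'\in E$; (iii) there is $C>0$ with $|F_t(u,\mu,x)|\le C(1+\mu(\mathbb R^n))$ and $|G_t(u,\mu,x)|\le C$ for all $t\in I,u\in U,\mu\in\mathcal X,x\in\mathbb R^n$. Barycentric projection: $\beta\colon\mathcal Y\to\mathcal X$ is defined by $\langle\beta(\rho),\phi\rangle=\int y\,\phi(x)\,d\rho(x,y)$ for $\phi\in C_0(\mathbb R^n)$. With $\bm x=(x,y)\in\mathbb R^n\times\mathbb R$, define $\bm F_t(u,\rho,\bm x)=\big(F_t(u,\beta(\rho),x),\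 y\,G_t(u,\beta(\rho),x)\big)\in\mathbb R^{n+1}$ for $\rho\in\mathcal Y$; $\bm F_t(u,\rho)$ denotes $\bm x\mapsto\bm F_t(u,\rho,\bm x)$. Distributional solutions: $\mu\colon I\to\mathcal X$ solves the balance law if $\mu_0=\vartheta$ and, for every $\phi\in C^1(\mathbb R^n)$, $t\mapsto\langle\mu_t,\phi\rangle$ is absolutely continuous with $\frac{d}{dt}\langle\mu_t,\phi\rangle=\langle\mu_t,\nabla_x\phi\cdot F_t(u_t,\mu_t)+G_t(u_t,\mu_t)\phi\rangle$ for a.e. $t\in I$. Likewise $\rho\colon I\to\mathcal Y$ solves the continuity equation if $\rho_0=\vartheta\otimes\delta_1$ and, for every $\bm\phi\in C^1(\mathbb R^n\times\mathbb R^+)$, $t\mapsto\langle\rho_t,\bm\phi\rangle$ is absolutely continuous with $\frac{d}{dt}\langle\rho_t,\bm\phi\rangle=\langle\rho_t,\nabla_{\bm x}\bm\phi\cdot\bm F_t(u_t,\rho_t)\rangle$ for a.e. $t$. Under Assumption A both Cauchy problems are known to have unique solutions. *)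

(* Defs.v *)
From HB Require Import structures.
From mathcomp Require Import all_boot all_order all_algebra.
From mathcomp Require Import all_classical all_reals all_analysis.
From mathcomp Require Import measurable_realfun.

Set Implicit Arguments.
Unset Strict Implicit.
Unset Printing Implicit Defensive.

Import Order.TTheory GRing.Theory Num.Theory.
Import numFieldNormedType.Exports.

Local Open Scope classical_set_scope.
Local Open Scope ring_scope.

(* R^n is 'rV[R]_n with its Borel sigma-algebra; R^n x R carries the product
   sigma-algebra, which is its Borel sigma-algebra by second countability. *)
HB.instance Definition _ (R : realType) (m n : nat) :=
  @isMeasurable.Build default_measure_display 'M[R]_(m, n)
    <<s @open 'M[R]_(m, n) >>
    (@measurable0 _ (g_sigma_algebraType (@open 'M[R]_(m, n))))
    (@measurableC _ (g_sigma_algebraType (@open 'M[R]_(m, n))))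
    (@bigcupT_measurable _ (g_sigma_algebraType (@open 'M[R]_(m, n)))).

(* Euclidean norm; the library norm `|x| on 'rV[R]_n is the sup norm. *)
Definition enorm (R : realType) (n : nat) (x : 'rV[R]_n) : R :=
  Num.sqrt (\sum_(i < n) x ord0 i ^+ 2).

(* "mu is supported in E". Negligibility of the complement avoids asking that
   it be measurable. *)
Definition supported_in d (T : measurableType d) (R : realType)
  (mu : set T -> \bar R) (E : set T) : Prop := mu.-negligible (~` E).

Record cmeasure (R : realType) (n : nat) := CMeasure {
  cmeasure_measure :> {finite_measure set 'rV[R]_n -> \bar R};
  cmeasure_compact :
    exists2 K : set 'rV[R]_n, compact K & supported_in cmeasure_measure K }.

Record cprobability (R : realType) (n : nat) := CProbability {
  cprobability_measure :> probability 'rV[R]_n R;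
  cprobability_compact :
    exists2 K : set 'rV[R]_n, compact K & supported_in cprobability_measure K }.

Definition halfspace (R : realType) (n : nat) : set ('rV[R]_n * R) :=
  [set z | 0 <= z.2].
Arguments halfspace : clear implicits.

(* P_c(R^n x R^+), as probabilities on R^n x R supported in a compact subset
   of R^n x R^+. *)
Record cprobability_half (R : realType) (n : nat) := CProbabilityHalf {
  cprobability_half_measure :> probability ('rV[R]_n * R)%type R;
  cprobability_half_compact :
    exists K : set ('rV[R]_n * R),
      [/\ compact K, K `<=` halfspace R n
        & supported_in cprobability_half_measure K] }.

Lemma measurable_halfspace (R : realType) (n : nat) :
  measurable (halfspace R n).
Proof.
rewrite (_ : halfspace R n = setT `&` snd @^-1` `[0, +oo[%classic).
  exact: measurable_snd.
by apply/seteqP; split => z /=; rewrite /halfspace /= in_itv /= andbT; tauto.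
Qed.

Section barycentric_projection.
Context (R : realType) (n : nat) (rho : cprobability_half R n).
Local Open Scope ereal_scope.

Let H := halfspace R n.
Let mH : measurable H. Proof. exact: measurable_halfspace. Qed.

Let msnd (D : set ('rV[R]_n * R)) : measurable_fun D (fun z => (z.2)%:E : \bar R).
Proof.
apply/measurable_EFinP; apply: (@measurable_funTS).
exact: measurable_snd.
Qed.

Let mfst (A : set 'rV[R]_n) : measurable A ->
  measurable (fst @^-1` A : set ('rV[R]_n * R)).
Proof. by move=> mA; rewrite -[_ @^-1` _]setTI; exact: measurable_fst. Qed.

(* First marginal of y rho, restricted to y >= 0; beta_pairing below is the
   duality formula that characterizes it. *)
Definition bary (A : set 'rV[R]_n) : \bar R :=
  \int[rho]_(z in fst @^-1` A `&` H) (z.2)%:E.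

Let bary0 : bary set0 = 0.
Proof. by rewrite /bary preimage_set0 set0I integral_set0. Qed.

Let bary_ge0 A : 0 <= bary A.
Proof. by apply: integral_ge0 => z [_]; rewrite lee_fin. Qed.

Let bary_sigma_additive : semi_sigma_additive bary.
Proof.
move=> F mF tF mUF; rewrite [X in _ --> X](_ : _ = \sum_(k <oo) bary (F k)).
  apply: is_cvg_ereal_nneg_natsum => k _; exact: bary_ge0.
rewrite /bary preimage_bigcup setI_bigcupl ge0_integral_bigcup//.
- by move=> k; apply: measurableI => //; exact: mfst.
- by move=> z [k _ [_]]; rewrite lee_fin.
- apply/trivIsetP => i j _ _ ij; move/trivIsetP : tF => /(_ i j I I ij) Fij.
  rewrite setIACA setIid -preimage_setI Fij preimage_set0 set0I //.
Qed.

HB.instance Definition _ := isMeasure.Build _ _ _ bary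
  bary0 bary_ge0 bary_sigma_additive.

Let support : exists K N M, [/\ compact K, measurable N, rho N = 0,
  ~` K `<=` N & forall z, ~ N z -> (z.2 <= M)%R].
Proof.
have [K [cK KH [N [mN N0 KN]]]] := cprobability_half_compact rho.
have [M [Mr MK]] := compact_bounded cK.
exists K, N, (M + 1)%R; split => // z Nz.
have Kz : K z by apply: contrapT => Kz; apply: Nz; exact: KN.
have zM : (`|z| <= M + 1)%R := MK (M + 1)%R (ltr_pwDr ltr01 (lexx _)) z Kz.
by apply: le_trans zM; rewrite prod_normE le_max ler_norm orbT.
Qed.

Let bary_fin : fin_num_fun bary.
Proof.
move=> A mA; have [K [N [M [_ mN N0 _ NM]]]] := support.
have mAH : measurable (fst @^-1` A `&` H).
  by apply: measurableI => //; exact: mfst.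
rewrite ge0_fin_numE ?bary_ge0// /bary (ge0_negligible_integral mN)//; last first.
  by move=> z [_]; rewrite lee_fin.
apply: (@le_lt_trans _ _ (\int[rho]_(z in (fst @^-1` A `&` H) `\` N) `|M|%:E)).
  apply: ge0_le_integral => //.
  - exact: measurableD.
  - by move=> z [[_ ?] _]; rewrite lee_fin.
  - by move=> z [_ /NM]; rewrite lee_fin => /le_trans; apply; exact: ler_norm.
rewrite integral_cst//; last exact: measurableD.
rewrite lte_mul_pinfty// -ge0_fin_numE// fin_num_measure//.
exact: measurableD.
Qed.

HB.instance Definition _ := Measure_isFinite.Build _ _ _ bary bary_fin.

Let bary_compact :
  exists2 K : set 'rV[R]_n, compact K & supported_in bary K.
Proof.
have [K [N [M [cK mN N0 KN _]]]] := support.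
have cfK : compact (fst @` K).
  apply: continuous_compact => //.
  by apply: continuous_subspaceT => z; exact: cvg_fst.
exists (fst @` K) => //; exists (~` (fst @` K)).
have mfK : measurable (~` (fst @` K)).
  apply: sub_sigma_algebra; apply: closed_openC.
  by apply: compact_closed => //; exact: norm_hausdorff.
split => //.
have mAH : measurable (fst @^-1` (~` (fst @` K)) `&` H).
  by apply: measurableI => //; exact: mfst.
rewrite /bary (ge0_negligible_integral mN)//; last first.
  by move=> z [_]; rewrite lee_fin.
rewrite (_ : _ `\` _ = set0) ?integral_set0//.
apply/seteqP; split => // z [[fz _] Nz]; apply: fz => /=; exists z => //.
by apply: contrapT => Kz; apply: Nz; exact: KN.
Qed.

Definition beta : cmeasure R n := CMeasure bary_compact.


Import HBNNSimple.

Lemma ge0_integral_bary (f : 'rV[R]_n -> \bar R) :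
  measurable_fun setT f -> (forall x, 0 <= f x) ->
  \int[bary]_x f x = \int[rho]_(z in H) ((z.2)%:E * f z.1).
Proof.
move=> mf f0; pose g := nnsfun_approx measurableT mf.
have gf x : EFin \o (fun k => g k x) @ \oo --> f x.
  by apply: cvg_nnsfun_approx => // ? _; exact: f0.
have mgfst k : measurable_fun H (fun z => (g k z.1)%:E : \bar R).
  apply/measurable_EFinP; apply: (@measurable_funTS).
  by apply: measurableT_comp => //; exact: measurable_fst.
transitivity (limn (fun k => \int[bary]_x (g k x)%:E)).
  rewrite -monotone_convergence//.
  - apply: eq_integral => x _; apply/esym/cvg_lim => //; exact: gf.
  - by move=> k; exact/measurable_EFinP.
  - by move=> k x _; rewrite lee_fin.
  - by move=> x _ k l kl; rewrite lee_fin; exact/lefP/nd_nnsfun_approx.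
transitivity (limn (fun k =>
    \int[rho]_(z in H) ((z.2)%:E * (g k z.1)%:E))); last first.
  rewrite -monotone_convergence//.
  - apply: eq_integral => z _; apply/cvg_lim => //.
    by apply: cvgeZl => //; exact: gf.
  - by move=> k; apply: emeasurable_funM.
  - by move=> k z Hz; rewrite mule_ge0 ?lee_fin.
  - move=> z Hz k l kl; rewrite lee_wpmul2l ?lee_fin//.
    exact/lefP/nd_nnsfun_approx.
congr (limn _); apply/funext => k; rewrite integralT_nnsfun sintegralE.
pose h (r : R) (z : 'rV[R]_n * R) : \bar R :=
  r%:E * ((z.2)%:E * (\1_(g k @^-1` [set r]) z.1)%:E).
transitivity (\int[rho]_(z in H) \sum_(r \in range (g k)) h r z); last first.
  apply: eq_integral => z; rewrite inE => Hz.
  rewrite [in RHS]fimfunE -fsumEFin// ge0_mule_fsumr; last first.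
    by move=> r; exact: (nnfun_muleindic_ge0 (g k)).
  by apply: eq_fsbigr => r _; rewrite /h muleCA.
have mind (r : R) : measurable_fun H
    (fun z => (z.2)%:E * (\1_(g k @^-1` [set r]) z.1)%:E : \bar R).
  apply: emeasurable_funM => //; apply/measurable_EFinP.
  apply: (@measurable_funTS).
  have mA : measurable (g k @^-1` [set r]) by exact: measurable_sfunP.
  exact: (measurableT_comp (@measurable_indic _ _ R setT _ mA) measurable_fst).
rewrite ge0_integral_fsum//; last 2 first.
- by move=> r; exact: measurable_funeM.
- move=> r z Hz; rewrite /h muleCA mule_ge0 ?lee_fin//.
  exact: (nnfun_muleindic_ge0 (g k)).
apply: eq_fsbigr => r /[!inE] -[x _ <-].
rewrite /h ge0_integralZl//; last 2 first.
- by move=> z Hz; rewrite mule_ge0 ?lee_fin// indicE.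
- by rewrite lee_fin.
congr (_ * _).
transitivity (\int[rho]_(z in H `&` fst @^-1` (g k @^-1` [set g k x])) (z.2)%:E).
  by rewrite setIC.
rewrite integral_mkcondr.
apply: eq_integral => z _; rewrite patchE indicE/=.
have -> : (z \in fst @^-1` (g k @^-1` [set g k x])) =
          (z.1 \in g k @^-1` [set g k x]) by apply/idP/idP; rewrite !inE.
by case: ifPn => _; rewrite ?mule1 ?mule0.
Qed.

Let integral_halfspace (f : 'rV[R]_n * R -> \bar R) :
  measurable_fun setT f -> (forall z, 0 <= f z) ->
  \int[rho]_z f z = \int[rho]_(z in H) f z.
Proof.
move=> mf f0; have [K [_ KH [N [mN N0 KN]]]] := cprobability_half_compact rho.
rewrite (ge0_negligible_integral mN)// [RHS](ge0_negligible_integral mN)//.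
  congr (integral _ _ _); apply/seteqP; split => z [Hz Nz]; split => //.
  by apply: KH; apply: contrapT => Kz; apply: Nz; exact: KN.
exact: measurable_funTS.
Qed.

Lemma beta_pairing (phi : 'rV[R]_n -> R) : measurable_fun setT phi ->
  (\int[beta]_x phi x = \int[rho]_z (z.2 * phi z.1))%R.
Proof.
move=> mphi; rewrite /Rintegral; congr fine.
have mf : measurable_fun setT (fun x => (phi x)%:E : \bar R).
  exact/measurable_EFinP.
have mg : measurable_fun setT
    (fun z : 'rV[R]_n * R => (z.2 * phi z.1)%:E : \bar R).
  apply/measurable_EFinP; apply: measurable_funM; first exact: measurable_snd.
  by apply: measurableT_comp => //; exact: measurable_fst.
rewrite integralE [RHS]integralE; congr (_ - _).
- rewrite integral_halfspace//; last exact: measurable_funepos.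
  rewrite [LHS]ge0_integral_bary//; last exact: measurable_funepos.
  apply: eq_integral => z; rewrite inE => Hz; rewrite !funeposE EFinM.
  by rewrite -[in LHS]EFin_max -[in RHS]EFinM -EFin_max -EFinM maxr_pMr// mulr0.
- rewrite integral_halfspace//; last exact: measurable_funeneg.
  rewrite [LHS]ge0_integral_bary//; last exact: measurable_funeneg.
  apply: eq_integral => z; rewrite inE => Hz; rewrite !funenegE -!EFinN.
  by rewrite -!EFin_max -EFinM maxr_pMr// mulr0 mulrN.
Qed.

End barycentric_projection.

Definition kr_test (R : realType) (n : nat) (phi : 'rV[R]_n -> R) : Prop :=
  [/\ continuous phi,
      forall x, `|phi x| <= 1
    & forall x y, `|phi x - phi y| <= enorm (x - y)].

(* |mu - nu|_K *)
Definition kr_dist (R : realType) (n : nat) (mu nu : cmeasure R n) : R :=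
  sup [set r | exists2 phi, kr_test phi
                          & r = \int[mu]_x phi x - \int[nu]_x phi x].

Section control_system.
Context (R : realType) (n m : nat) (T : R) (U : set 'rV[R]_m).
Context (F : R -> 'rV[R]_m -> cmeasure R n -> 'rV[R]_n -> 'rV[R]_n).
Context (G : R -> 'rV[R]_m -> cmeasure R n -> 'rV[R]_n -> R).

Record assumptionA : Prop := AssumptionA {
  A_continuousF : forall mu x, {within `[0, T]%classic `*` U,
    continuous (fun tu : R * 'rV[R]_m => F tu.1 tu.2 mu x)};
  A_continuousG : forall mu x, {within `[0, T]%classic `*` U,
    continuous (fun tu : R * 'rV[R]_m => G tu.1 tu.2 mu x)};
  A_lipschitz : forall E : set 'rV[R]_n, compact E -> exists2 M : R, 0 < M &
    forall t u (mu mu' : cmeasure R n) x x', t \in `[0, T] -> U u ->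
      supported_in mu E -> supported_in mu' E -> E x -> E x' ->
      enorm (F t u mu x - F t u mu' x')
        <= M * (enorm (x - x') + kr_dist mu mu') /\
      `|G t u mu x - G t u mu' x'|
        <= M * (enorm (x - x') + kr_dist mu mu');
  A_growth : exists2 C : R, 0 < C &
    forall t u (mu : cmeasure R n) x, t \in `[0, T] -> U u ->
      enorm (F t u mu x) <= C * (1 + fine (mu setT)) /\ `|G t u mu x| <= C }.

(* Measurability is with respect to the Lebesgue sigma-algebra, the completion
   of the Borel one. *)
Definition control (u : R -> 'rV[R]_m) : Prop :=
  (forall t, t \in `[0, T] -> U (u t)) /\
  @measurable_fun _ _
    (g_sigma_algebraType (completed_algebra_gen (@lebesgue_measure R)))
    'rV[R]_m `[0, T]%classic u.

End control_system.

Definition C1 (R : realType) (V : normedModType R) (phi : V -> R) : Prop :=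
  (forall x, differentiable phi x) /\
  (forall v, continuous (fun x => 'd phi x v)).

Definition absolutely_continuous (R : realType) (a b : R) (f : R -> R) : Prop :=
  forall e, 0 < e -> exists2 d, 0 < d &
    forall (k : nat) (s t : 'I_k -> R),
      (forall i, [/\ a <= s i, s i <= t i & t i <= b]) ->
      (forall i j, i != j -> t i <= s j \/ t j <= s i) ->
      \sum_(i < k) (t i - s i) < d ->
      \sum_(i < k) `|f (t i) - f (s i)| < e.

Section cauchy_problems.
Context (R : realType) (n m : nat) (T : R).
Context (F : R -> 'rV[R]_m -> cmeasure R n -> 'rV[R]_n -> 'rV[R]_n).
Context (G : R -> 'rV[R]_m -> cmeasure R n -> 'rV[R]_n -> R).
Context (theta : cprobability R n) (u : R -> 'rV[R]_m).

(* Curves are total functions of the time variable, but only their values on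
   [0, T] matter. Measures are compared on measurable sets, because the library
   type of measures also records irrelevant values on the other sets. The
   product of the gradient of phi at x with w is 'd phi x w. *)

Definition balance_law (mu : R -> cmeasure R n) : Prop :=
  (forall A, measurable A -> mu 0 A = theta A) /\
  (forall phi : 'rV[R]_n -> R, C1 phi ->
    absolutely_continuous 0 T (fun t => \int[mu t]_x phi x) /\
    {ae @lebesgue_measure R, forall t : R, t \in `[0, T] ->
      is_derive t (1 : R) (fun s : R => \int[mu s]_x phi x)
        (\int[mu t]_x ('d phi x (F t (u t) (mu t) x)
                       + G t (u t) (mu t) x * phi x))}).

Definition lifted_field (t : R) (v : 'rV[R]_m) (rho : cprobability_half R n)
    (z : 'rV[R]_n * R) : 'rV[R]_n * R :=
  (F t v (beta rho) z.1, z.2 * G t v (beta rho) z.1).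

(* A C^1 function on the closed half-space R^n x R^+ is the restriction of a C^1
   function on R^n x R; the values outside the half-space do not contribute to
   the integrals. *)
Definition continuity_equation (rho : R -> cprobability_half R n) : Prop :=
  (forall A, measurable A -> rho 0 A = (theta \x \d_(1%R : R))%E A) /\
  (forall phi : 'rV[R]_n * R -> R, C1 phi ->
    absolutely_continuous 0 T (fun t => \int[rho t]_z phi z) /\
    {ae @lebesgue_measure R, forall t : R, t \in `[0, T] ->
      is_derive t (1 : R) (fun s : R => \int[rho s]_z phi z)
        (\int[rho t]_z 'd phi z (lifted_field t (u t) (rho t) z))}).

Definition unique_balance_law (mu : R -> cmeasure R n) : Prop :=
  balance_law mu /\
  forall mu', balance_law mu' ->
    forall t, t \in `[0, T] -> forall A, measurable A -> mu' t A = mu t A.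

Definition unique_continuity_equation (rho : R -> cprobability_half R n) :
    Prop :=
  continuity_equation rho /\
  forall rho', continuity_equation rho' ->
    forall t, t \in `[0, T] -> forall A, measurable A -> rho' t A = rho t A.

End cauchy_problems.

(* Main.v *)
Require Import Defs.
From mathcomp Require Import all_boot all_order all_algebra.
From mathcomp Require Import all_classical all_reals all_analysis.
From mathcomp Require Import measurable_realfun.
From mathcomp Require Import ring.
Import Order.TTheory GRing.Theory Num.Theory.
Import numFieldNormedType.Exports.
Local Open Scope classical_set_scope.
Local Open Scope ring_scope.

(** The curve [beta (rho t)] solves the balance law, so it is [mu t] because
    that law has only one solution.

    Integrating a test function [phi] against [beta (rho t)] amounts to
    integrating [y * phi x] against [rho t] ([beta_pairing]). The function
    [y * phi x] is of class C^1 when [phi] is ([C1_weighted_test]), so the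
    continuity equation may be tested with it: this gives at once the absolute
    continuity of the pairing, and its derivative at almost every time. The
    derivative of [y * phi x] along the lifted field [(F, y * G)] is
    [y * 'd phi x F + y * G * phi x = y * ('d phi x F + G * phi x)], that is,
    [y] times the integrand of the balance law, so the pairing formula read
    backwards turns the one equation into the other
    ([beta_pairing_lifted_field]). At time 0 the weight [y] equals 1 almost
    everywhere, hence [beta (rho 0) = theta] ([beta_initial]).

    The one analytic point is that the pairing formula asks for a measurable
    integrand. The fields [F] and [G] are only known to be Lipschitz in [x] on
    compact sets that carry the measure; enlarging the support of the measure by
    a compact neighbourhood of a given point shows that they are continuous in
    [x] ([assumptionA_continuous]). *)

Lemma coord_le_enorm {R : realType} {n : nat} (x : 'rV[R]_n) (i : 'I_n) :
  `|x ord0 i| <= enorm x.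
Proof.
rewrite /enorm -sqrtr_sqr ler_wsqrtr// (bigD1 i)//= lerDl.
by apply: sumr_ge0 => j _; exact: sqr_ge0.
Qed.

Lemma enorm_le_norm {R : realType} {n : nat} (x : 'rV[R]_n) :
  enorm x <= Num.sqrt n%:R * `|x|.
Proof.
rewrite /enorm -[`|x|]normr_id -sqrtr_sqr -sqrtrM ?ler0n// ler_wsqrtr//.
rewrite mulr_natl -[n in _ *+ n]card_ord -sumr_const ler_sum// => i _.
rewrite -real_normK ?num_real// lerXn2r ?nnegrE//.
rewrite [leRHS]mx_normrE.
exact: (le_bigmax _ (fun ij : 'I_1 * 'I_n => `|x ij.1 ij.2|) (ord0, i)).
Qed.

Lemma continuous_measurable_row {R : realType} {n : nat} (f : 'rV[R]_n -> R) :
  continuous f -> measurable_fun setT f.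
Proof.
move=> /continuousP cf; apply: (measurability _ (RGenOpens.measurableE R)).
move=> _ [B [a [b ->]] <-]; rewrite setTI; apply: sub_sigma_algebra.
by apply: cf; exact: interval_open.
Qed.

(** Lipschitz estimates are given in the Euclidean norm, whereas neighbourhoods
    are those of the sup norm; the two are compared by [enorm_le_norm]. *)
Lemma locally_lipschitz_continuous {R : realType} {n : nat}
    (f : 'rV[R]_n -> R) :
  (forall x, exists M, \forall y \near x, `|f x - f y| <= M * enorm (x - y)) ->
  continuous f.
Proof.
move=> lipf x; have [M fM] := lipf x.
(* Adding 1 makes the constant positive, so that one can divide by it. *)
pose L := `|M| * Num.sqrt n%:R + 1.
have L0 : 0 < L by rewrite ltr_wpDl// mulr_ge0// sqrtr_ge0.
apply/(@cvgrPdist_le _ _ _ (nbhs x)) => e e0.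
have xe : \forall y \near x, `|x - y| <= e / L.
  by apply: (@cvgr_dist_le _ _ _ (nbhs x) _ id x cvg_id); exact: divr_gt0.
near=> y.
have fxy : `|f x - f y| <= M * enorm (x - y) by near: y.
apply: (le_trans fxy); apply: (@le_trans _ _ (L * `|x - y|)).
  apply: (@le_trans _ _ (`|M| * enorm (x - y))).
    by rewrite ler_wpM2r ?ler_norm// sqrtr_ge0.
  by rewrite mulrDl -mulrA mul1r ler_wpDr// ler_wpM2l// enorm_le_norm.
by rewrite mulrC -ler_pdivlMr//; near: y.
Unshelve. all: by end_near. Qed.

Lemma compact_cube {R : realType} {n : nat} (x : 'rV[R]_n) :
  exists2 Q : set 'rV[R]_n, compact Q & \forall y \near x, Q y.
Proof.
exists [set v | forall i, `[x ord0 i - 1, x ord0 i + 1]%classic (v ord0 i)].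
  apply: (@rV_compact R n (fun i => `[x ord0 i - 1, x ord0 i + 1]%classic)).
  by move=> i; exact: segment_compact.
apply/nbhs_ballP; exists 1 => //= y [_ xy] i /=.
have := xy ord0 i; rewrite /ball /= distrC => /ltW.
by rewrite ler_distl in_itv.
Qed.

(** With it, the Lipschitz estimate for a pair of equal measures bounds the
    variation in [x] alone. *)
Lemma kr_dist_self {R : realType} {n : nat} (mu : cmeasure R n) :
  kr_dist mu mu = 0.
Proof.
rewrite /kr_dist (_ : [set r | _] = [set 0]) ?sup1//.
apply/seteqP; split => [r [phi _ ->]|_ ->]; first exact: subrr.
exists (cst 0); last by rewrite subrr.
split => [|x|x y]; first exact: cst_continuous.
- by rewrite normr0.
- by rewrite subrr normr0 sqrtr_ge0.
Qed.

(** The Lipschitz estimate is available on compact sets that carry [mu], and such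
    a set need not be a neighbourhood of [x]. The union of the support of [mu]
    and a cube around [x] is still compact, carries [mu], and is one. *)
Lemma assumptionA_continuous {R : realType} {n m : nat} {T : R}
    {U : set 'rV[R]_m}
    {F : R -> 'rV[R]_m -> cmeasure R n -> 'rV[R]_n -> 'rV[R]_n}
    {G : R -> 'rV[R]_m -> cmeasure R n -> 'rV[R]_n -> R}
    {t : R} {v : 'rV[R]_m} (mu : cmeasure R n) :
  assumptionA T U F G -> t \in `[0, T] -> U v ->
  (forall i, continuous (fun x => F t v mu x ord0 i)) /\
  continuous (G t v mu).
Proof.
move=> hA tT Uv.
suff lip x : exists M, \forall y \near x,
    enorm (F t v mu x - F t v mu y) <= M * enorm (x - y) /\
    `|G t v mu x - G t v mu y| <= M * enorm (x - y).
  split=> [i|]; apply: locally_lipschitz_continuous => x;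
    have [M lipM] := lip x; exists M; near=> y.
    have [FM _] : enorm (F t v mu x - F t v mu y) <= M * enorm (x - y) /\
      `|G t v mu x - G t v mu y| <= M * enorm (x - y) by near: y.
    apply: le_trans FM.
    by have := coord_le_enorm (F t v mu x - F t v mu y) i; rewrite !mxE.
  have [_ //] : enorm (F t v mu x - F t v mu y) <= M * enorm (x - y) /\
    `|G t v mu x - G t v mu y| <= M * enorm (x - y) by near: y.
have [K cK Kmu] := cmeasure_compact mu.
have [Q cQ Qx] := compact_cube x.
have muKQ : supported_in mu (K `|` Q).
  by apply: negligibleS Kmu; apply: subsetC; exact: subsetUl.
have [M _ lipM] := A_lipschitz hA (compactU cK cQ).
exists M; near=> y.
have Qy : Q y by near: y.
have := lipM t v mu mu x y tT Uv muKQ muKQ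
  (or_intror (nbhs_singleton Qx)) (or_intror Qy).
by rewrite kr_dist_self addr0.
Unshelve. all: by end_near. Qed.

(** The pullback of [phi] under the duality that defines [beta]. *)
Definition weighted_test {R : realType} {n : nat} (phi : 'rV[R]_n -> R)
  (z : 'rV[R]_n * R) : R := z.2 * phi z.1.

Lemma is_diff_weighted_test {R : realType} {n : nat} (phi : 'rV[R]_n -> R)
    (z : 'rV[R]_n * R) :
  differentiable phi z.1 ->
  is_diff z (weighted_test phi)
    (fun w : 'rV[R]_n * R => z.2 * 'd phi (z.1) (w.1) + phi z.1 * w.2).
Proof.
move=> /differentiableP dphi.
have d1 : is_diff z (fst : 'rV[R]_n * R -> 'rV[R]_n) fst.
  apply: DiffDef; first by apply: linear_differentiable => y; exact: cvg_fst.
  by apply: diff_lin => y; exact: cvg_fst.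
have d2 : is_diff z (snd : 'rV[R]_n * R -> R) snd.
  apply: DiffDef; first by apply: linear_differentiable => y; exact: cvg_snd.
  by apply: diff_lin => y; exact: cvg_snd.
exact: (is_diffM d2 (is_diff_comp d1 dphi)).
Qed.

Lemma C1_continuous {R : realType} {V : normedModType R} (phi : V -> R) :
  C1 phi -> continuous phi.
Proof. by case=> dphi _ x; exact: differentiable_continuous. Qed.

Lemma C1_weighted_test {R : realType} {n : nat} (phi : 'rV[R]_n -> R) :
  C1 phi -> C1 (weighted_test phi).
Proof.
move=> C1phi; have [dphi cphi] := C1phi.
have Dphi z := is_diff_weighted_test phi z (dphi z.1).
split=> [z|w]; first by have := Dphi z; case.
rewrite (_ : (fun z => _) = (fun z : 'rV[R]_n * R =>
    z.2 * 'd phi (z.1) (w.1) + phi z.1 * w.2)); last first.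
  by apply/funext => z; rewrite (@diff_val _ _ _ _ _ _ _ (Dphi z)).
have cfst (g : 'rV[R]_n -> R) : continuous g ->
    continuous (fun z : 'rV[R]_n * R => g z.1).
  by move=> cg z; apply: (continuous_comp (f := fst)); [exact: cvg_fst|exact: cg].
move=> z; apply: cvgD; apply: cvgM.
- exact: cvg_snd.
- exact: (cfst (fun x => 'd phi x w.1)).
- by apply: cfst; exact: C1_continuous.
- exact: cvg_cst.
Qed.

(** Being C^1 controls ['d phi x v] for a fixed direction [v] only; expanding the
    moving direction [f x] in the canonical basis reduces to that case. *)
Lemma continuous_diff_along {R : realType} {n : nat} (phi : 'rV[R]_n -> R)
    (f : 'rV[R]_n -> 'rV[R]_n) :
  C1 phi -> (forall i, continuous (fun x => f x ord0 i)) ->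
  continuous (fun x => 'd phi x (f x)).
Proof.
move=> [_ cphi] cf.
rewrite (_ : (fun x => _) = (fun x => \sum_i
    f x ord0 i * 'd phi x (delta_mx ord0 i))); last first.
  apply/funext => x; rewrite [in LHS](row_sum_delta (f x)) linear_sum.
  by apply: eq_bigr => i _; rewrite linearZ.
apply: continuous_big => [|i _ x]; first exact: add_continuous.
by apply: (@cvgM _ _ (nbhs x)); [exact: cf|exact: cphi].
Qed.

(** The initial measure gives no mass to [y != 1]; off that set the integral
    defining [beta rho A] is the measure of [A `*` [set 1]]. *)
Lemma beta_initial {R : realType} {n : nat} (theta : cprobability R n)
    (rho : cprobability_half R n) :
  (forall A, measurable A -> rho A = (theta \x \d_(1%R : R))%E A) ->
  forall A, measurable A -> beta rho A = theta A.
Proof.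
move=> rho0 A mA /=; rewrite /bary.
have m1 : measurable ([set 1] : set R) by exact: measurable_set1.
have mH := @measurable_halfspace R n.
have mfA : measurable (fst @^-1` A : set ('rV[R]_n * R)).
  by rewrite -[_ @^-1` _]setTI; exact: measurable_fst.
have mN : measurable ([set: 'rV[R]_n] `*` ~` [set 1 : R]).
  by apply: measurableX => //; exact: measurableC.
have N0 : rho ([set: 'rV[R]_n] `*` ~` [set 1 : R]) = 0%E.
  rewrite rho0// product_measure1E//; last exact: measurableC.
  rewrite /= diracE (_ : _ \in _ = false) ?mule0//.
  by apply/negbTE; rewrite notin_setE /=; apply.
rewrite (ge0_negligible_integral mN)//; last 3 first.
- exact: measurableI.
- by apply/measurable_EFinP; apply: (@measurable_funTS); exact: measurable_snd.
- by move=> z [_]; rewrite lee_fin.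
rewrite (_ : _ `\` _ = A `*` [set 1]); last first.
  apply/seteqP; split => -[x y] /=.
    by move=> [[Ax _] Ny]; split=> //; apply: contrapT => y1; exact: Ny.
  by move=> [Ax ->]; do !split => //; [exact: ler01|case].
rewrite (eq_integral (cst 1%E)); last by move=> [x y] /[!inE] -[_ /= ->].
rewrite integral_cst ?mul1e; last exact: measurableX.
transitivity ((theta \x \d_(1%R : R))%E (A `*` [set 1])).
  by apply: rho0; exact: measurableX.
by rewrite product_measure1E//= diracE mem_set// mule1.
Qed.

(** This is where the source term comes from: the second component [y * G] of the
    lifted field differentiates the weight [y] into [G], while the first one
    transports [phi] along [F]. *)
Lemma beta_pairing_lifted_field {R : realType} {n m : nat} {T : R}
    {U : set 'rV[R]_m}
    {F : R -> 'rV[R]_m -> cmeasure R n -> 'rV[R]_n -> 'rV[R]_n}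
    {G : R -> 'rV[R]_m -> cmeasure R n -> 'rV[R]_n -> R}
    {t : R} {v : 'rV[R]_m} (rho : cprobability_half R n)
    (phi : 'rV[R]_n -> R) :
  assumptionA T U F G -> t \in `[0, T] -> U v -> C1 phi ->
  \int[rho]_z 'd (weighted_test phi) z (lifted_field F G t v rho z) =
  \int[beta rho]_x ('d phi x (F t v (beta rho) x)
                    + G t v (beta rho) x * phi x).
Proof.
move=> hA tT Uv C1phi.
have [cF cG] := assumptionA_continuous (beta rho) hA tT Uv.
rewrite beta_pairing; last first.
  apply: continuous_measurable_row => x; apply: (@cvgD _ _ _ (nbhs x)).
    exact: (continuous_diff_along _ _ C1phi cF).
  by apply: (@cvgM _ _ (nbhs x)); [exact: cG|exact: C1_continuous].
congr (fine _); apply: eq_integral => z _; congr EFin.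
rewrite (@diff_val _ _ _ _ _ _ _ (is_diff_weighted_test phi z (C1phi.1 z.1))).
by rewrite /lifted_field /= mulrDr; congr (_ + _); ring.
Qed.

Theorem theorem1 (R : realType) (n m : nat) (T : R) (U : set 'rV[R]_m)
    (F : R -> 'rV[R]_m -> cmeasure R n -> 'rV[R]_n -> 'rV[R]_n)
    (G : R -> 'rV[R]_m -> cmeasure R n -> 'rV[R]_n -> R)
    (theta : cprobability R n) (u : R -> 'rV[R]_m)
    (mu : R -> cmeasure R n) (rho : R -> cprobability_half R n) :
  0 < T -> compact U -> assumptionA T U F G -> control T U u ->
  unique_balance_law T F G theta u mu ->
  unique_continuity_equation T F G theta u rho ->
  forall t : R, t \in `[0, T] ->
  forall A : set 'rV[R]_n, measurable A -> mu t A = beta (rho t) A.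
Proof.
move=> _ _ hA [uU _] [_ mu_unique] [[rho0 rho_eq] _] t tT A mA.
apply/esym/(mu_unique (fun s => beta (rho s))) => //; split.
  exact: beta_initial.
move=> phi C1phi.
have [ac der] := rho_eq _ (C1_weighted_test _ C1phi).
have pairE : (fun s => \int[beta (rho s)]_x phi x) =
    (fun s => \int[rho s]_z weighted_test phi z).
  apply/funext => s; apply: beta_pairing.
  by apply: continuous_measurable_row; exact: C1_continuous.
rewrite pairE; split=> //.
apply: negligibleS der; apply: subsetC => s der sT.
rewrite -(beta_pairing_lifted_field _ _ hA sT (uU s sT))//.
exact: der.
Qed.
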